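(* Let $\mathcal V$ be a commutative semigroup variety that is a modular element of the lattice $\mathbf{Com}$ of all commutative semigroup varieties. Then either $\mathcal V=\mathcal{COM}$, or $\mathcal V=\mathcal M\vee\mathcal N$ where $\mathcal M$ is one of the varieties $\mathcal T$ or $\mathcal{SL}$ and $\mathcal N$ is a nil-variety.
   Context: A semigroup variety is a class of semigroups defined by a set of semigroup identities. $\mathbf{Com}$ is the lattice (under inclusion) of all varieties consisting of commutative semigroups; meet is intersection and $\mathcal M\vee\mathcal N$ is the least variety containing $\mathcal M$ and $\mathcal N$. $\mathcal{COM}$ is the variety of all commutative semigroups, $\mathcal T$ is the trivial variety, and $\mathcal{SL}$ is the variety of all semilattices (semigroups satisfying $xy=yx$ and $x^2=x$). A semigroup variety is a nil-variety if it consists of nil-semigroups; equivalently, it satisfies an identity $x^n=0$ for some natural $n$, where $w=0$ abbreviates the pair of identities $wy=yw=w$ with $y$ a letter not occurring in $w$. An element $x$ of a lattice $L$ is modular if for all $y,z\in L$ with $y\le z$ one has $(x\vee y)\wedge z=(x\wedge z)\vee y$. *)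

(* Defs.v *)
From HB Require Import structures.
From mathcomp Require Import all_boot all_order.
From mathcomp Require Import boolp classical_sets.

Set Implicit Arguments.
Unset Strict Implicit.
Unset Printing Implicit Defensive.

Import Order.TTheory.

Local Open Scope classical_set_scope.

(* MathComp's [semigroupType] is not used: its carriers live in the universe
   shared by all MathComp structures, so that varieties of [semigroupType]s
   could not themselves form a [latticeType].  Carriers are nonempty (an empty
   semigroup would lie in every variety and is not a nil-semigroup). *)
Record semigroup := Semigroup {
  semigroup_sort :> Type;
  smul : semigroup_sort -> semigroup_sort -> semigroup_sort;
  smulA : associative smul;
  semigroup_inhabited : inhabited semigroup_sort
}.

Declare Scope semigroup_scope.
Delimit Scope semigroup_scope with S.
Bind Scope semigroup_scope with semigroup_sort.
Notation "x * y" := (smul x y) : semigroup_scope.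
Local Open Scope semigroup_scope.

(* The word x_i x_(j1) ... x_(jk) over the alphabet {x_0, x_1, ...} is encoded
   as (i, [:: j1; ...; jk]), so that words are nonempty. *)
Definition word := (nat * seq nat)%type.

Definition word_eval (S : semigroup) (h : nat -> S) (w : word) : S :=
  foldl (fun a j => a * h j) (h w.1) w.2.

Definition identity := (word * word)%type.

Definition satisfies (S : semigroup) (e : identity) : Prop :=
  forall h : nat -> S, word_eval h e.1 = word_eval h e.2.

Definition models (Sigma : set identity) : set semigroup :=
  [set S | forall e, Sigma e -> satisfies S e].

Definition theory (K : set semigroup) : set identity :=
  [set e | forall S, K S -> satisfies S e].

Definition is_variety (K : set semigroup) : Prop :=
  exists Sigma : set identity, K = models Sigma.

Definition commutative_semigroups : set semigroup :=
  [set S : semigroup | commutative (@smul S)].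

(* The elements of the lattice Com. *)
Record com_variety := ComVariety {
  variety_class :> set semigroup;
  variety_classP : is_variety variety_class;
  variety_commutative : variety_class `<=` commutative_semigroups
}.

Lemma com_variety_eq (V W : com_variety) :
  variety_class V = variety_class W -> V = W.
Proof.
case: V W => [K p q] [K' p' q'] /= E; subst K'.
by rewrite (Prop_irrelevance p p') (Prop_irrelevance q q').
Qed.

HB.instance Definition _ := gen_eqMixin com_variety.
HB.instance Definition _ := gen_choiceMixin com_variety.

Lemma theory_models (K : set semigroup) : K `<=` models (theory K).
Proof. by move=> S KS e; apply. Qed.

Lemma models_theory (K : set semigroup) :
  is_variety K -> models (theory K) = K.
Proof.
case=> Sigma ->; apply/seteqP; split; last exact: theory_models.
by move=> S MS e Se; apply: MS => S' MS'; apply: MS'.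
Qed.

Lemma is_variety_models Sigma : is_variety (models Sigma).
Proof. by exists Sigma. Qed.

Lemma is_varietyI K L : is_variety K -> is_variety L -> is_variety (K `&` L).
Proof.
case=> A -> [B ->]; exists (A `|` B); apply/seteqP; split=> S /=.
  by case=> SA SB e [/SA|/SB].
by move=> SAB; split=> e he; apply: SAB; [left|right].
Qed.

Definition comm_identity : identity := ((0, [:: 1]), (1, [:: 0])).

Lemma satisfies_commP (S : semigroup) :
  satisfies S comm_identity <-> commutative_semigroups S.
Proof.
split=> [H x y|H h]; last exact: H.
exact: (H (fun i => if i is 0 then x else y)).
Qed.

Fact COM_variety : is_variety commutative_semigroups.
Proof.
exists [set comm_identity]; apply/seteqP; split=> S /=.
  by move=> /satisfies_commP H e ->.
by move=> /(_ comm_identity erefl) /satisfies_commP.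
Qed.

Definition com_meet (V W : com_variety) : com_variety :=
  ComVariety (is_varietyI (variety_classP V) (variety_classP W))
    (fun S VWS => variety_commutative VWS.1).

(* The least variety containing K and L; see [variety_join_least]. *)
Definition variety_join (K L : set semigroup) : set semigroup :=
  models (theory (K `|` L)).

Lemma variety_join_least (K L M : set semigroup) :
  is_variety M -> variety_join K L `<=` M <-> K `<=` M /\ L `<=` M.
Proof.
move=> MP; split=> [H|[KM LM]].
  by split=> S HS; apply/H/theory_models; [left|right].
rewrite -(models_theory MP) => S JS e Me; apply: JS => S' [/KM|/LM] MS;
  exact: Me.
Qed.

Definition com_join (V W : com_variety) : com_variety :=
  @ComVariety (variety_join V W) (is_variety_models _)
    (proj2 (variety_join_least V W COM_variety)
       (conj (@variety_commutative V) (@variety_commutative W))).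

Definition com_le (V W : com_variety) : bool := `[< V `<=` W >].

Fact com_le_refl : reflexive com_le.
Proof. by move=> V; apply/asboolP. Qed.

Fact com_le_anti : antisymmetric com_le.
Proof.
move=> V W /andP[/asboolP VW /asboolP WV].
exact/com_variety_eq/seteqP.
Qed.

Fact com_le_trans : transitive com_le.
Proof.
move=> W V U /asboolP VW /asboolP WU; apply/asboolP.
exact: subset_trans VW WU.
Qed.

Fact com_display : Order.disp_t. Proof. exact: Order.Disp tt tt. Qed.

HB.instance Definition _ := Order.Le_isPOrder.Build
  com_display com_variety com_le_refl com_le_anti com_le_trans.

Lemma com_variety_leP (V W : com_variety) : reflect (V `<=` W) (V <= W)%O.
Proof. exact: asboolP. Qed.

Fact com_lexI (V W U : com_variety) :
  (V <= com_meet W U)%O = (V <= W)%O && (V <= U)%O.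
Proof.
apply/com_variety_leP/andP => [H|[/com_variety_leP VW /com_variety_leP VU]].
  by split; apply/com_variety_leP => S /H [].
by move=> S VS; split; [apply: VW|apply: VU].
Qed.

Fact com_leUx (V W U : com_variety) :
  (com_join V W <= U)%O = (V <= U)%O && (W <= U)%O.
Proof.
apply/com_variety_leP/andP => [|[/com_variety_leP VU /com_variety_leP WU]].
  move/(variety_join_least _ _ (variety_classP U)) => [VU WU].
  by split; apply/com_variety_leP.
exact/(variety_join_least _ _ (variety_classP U)).
Qed.

HB.instance Definition _ := Order.POrder_MeetJoin_isLattice.Build
  com_display com_variety com_lexI com_leUx.

Lemma com_meetE (V W : com_variety) : (V `&` W)%O = com_meet V W.
Proof. by []. Qed.

Lemma com_joinE (V W : com_variety) : (V `|` W)%O = com_join V W.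
Proof. by []. Qed.

Definition modular_element (d : Order.disp_t) (L : latticeType d) (x : L) :=
  forall y z : L, (y <= z -> (x `|` y) `&` z = (x `&` z) `|` y)%O.

Definition COM : com_variety := ComVariety COM_variety (@subset_refl _ _).

Definition trivial_semigroups : set semigroup :=
  [set S : semigroup | forall x y : S, x = y].

Fact TRIV_variety : is_variety trivial_semigroups.
Proof.
exists [set ((0, [::]), (1, [::]))]; apply/seteqP; split=> S /=.
  by move=> H e -> h; apply: H.
by move=> H x y; apply: (H _ erefl (fun i => if i is 0 then x else y)).
Qed.

Definition TRIV : com_variety :=
  ComVariety TRIV_variety (fun S trivS x y => trivS (x * y) (y * x)).

Definition semilattices : set semigroup :=
  commutative_semigroups `&` [set S : semigroup | idempotent_op (@smul S)].

Fact SL_variety : is_variety semilattices.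
Proof.
apply: is_varietyI; first exact: COM_variety.
exists [set ((0, [:: 0]), (0, [::]))]; apply/seteqP; split=> S /=.
  by move=> H e -> h; apply: H.
by move=> H x; apply: (H _ erefl (fun=> x)).
Qed.

Definition SL : com_variety := ComVariety SL_variety (@subIsetl _ _ _).

(* [iter n (smul x) x] is x^(n+1). *)
Definition nil_semigroups : set semigroup :=
  [set S : semigroup | exists2 z : S,
     left_zero z (@smul S) /\ right_zero z (@smul S) &
     forall x : S, exists n : nat, iter n (smul x) x = z].

Definition nil_variety (V : com_variety) : Prop := V `<=` nil_semigroups.

(* Main.v *)
(* Let V be modular and proper; then V satisfies x^(n+1) = x^(n+1+m) for some
   m > 0.  Take for Y the commutative variety given by
   x^(n+1) y^2 z = x^(n+1) y z^2, and for Z the one given by the same identity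
   with x^(n+1+m) in place of x^(n+1).  The identity of Y holds in V /\ Z and
   in Y, hence, by modularity, in (V \/ Y) /\ Z; as Z only sees longer words,
   it must hold in V.  Putting z = x^m gives x^(n+1) y^2 = x^(n+1) y.
   If V does not contain SL, a law of V whose sides have different letters now
   yields x^(n+2) = 0, so V is nil.  Otherwise V = SL \/ N with
   N = V /\ [x^(n+2) = 0]: given S in V, the ideal generated by the powers
   x^(n+2) consists of idempotents s with s y^2 = s y, on which the value of a
   word depends only on its set of letters, while the Rees quotient of S by this
   ideal lies in N. *)

Require Import Defs.
From mathcomp Require Import all_boot all_order.
From mathcomp Require Import boolp classical_sets zify.

Set Implicit Arguments.
Unset Strict Implicit.
Unset Printing Implicit Defensive.

Import Order.TTheory.

Local Open Scope classical_set_scope.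
Local Open Scope semigroup_scope.

(** * Words, homomorphisms and quotients *)

Definition letters (w : word) : seq nat := w.1 :: w.2.

(* As in [nil_semigroups], [spow x n] is x^(n+1). *)
Notation spow x n := (iter n (smul x) x).

Definition is_hom (S T : semigroup) (f : S -> T) := {morph f : x y / (x * y)%S}.

Lemma hom_word_eval (S T : semigroup) (f : S -> T) (h : nat -> S) w :
  is_hom f -> f (word_eval h w) = word_eval (f \o h) w.
Proof.
move=> fM; rewrite /word_eval; case: w => i s /=.
elim: s (h i) => //= j s IH a; rewrite IH fM.
by [].
Qed.

Lemma satisfies_image (S T : semigroup) (f : S -> T) e :
  is_hom f -> (forall y, exists x, f x = y) -> satisfies S e -> satisfies T e.
Proof.
move=> fM fsurj Se h.
have [g gK] := choice (fun i => fsurj (h i)).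
have -> : h = f \o g by apply: funext => i /=.
by rewrite -!hom_word_eval // Se.
Qed.

(** The congruence is presented as the kernel of [k], so the carrier can be the image of [k], with
    products taken on chosen preimages. *)
Lemma quotient_semigroup (S : semigroup) (K : Type) (k : S -> K) :
  (forall x x' y y', k x = k x' -> k y = k y' -> k (x * y) = k (x' * y')) ->
  exists (T : semigroup) (f : S -> T),
    [/\ is_hom f, forall y, exists x, f x = y
      & forall x y, f x = f y <-> k x = k y].
Proof.
move=> kM.
pose Q := {a : K | exists x, k x = a}.
pose f x : Q := exist _ (k x) (ex_intro _ x erefl).
pose r (q : Q) : S := sval (cid (svalP q)).
have fE x y : k x = k y -> f x = f y by move=> kxy; exact: eq_exist.
have kr q : k (r q) = sval q by rewrite /r; case: cid.
have fr q : f (r q) = q.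
  by apply: eq_sig_hprop => [? ? ?|]; [exact: Prop_irrelevance|exact: kr].
pose m p q := f (r p * r q).
have fM x y : f (x * y) = m (f x) (f y) by apply/fE/kM; rewrite kr.
have mA : associative m.
  by move=> a b c; rewrite -(fr a) -(fr b) -(fr c) -!fM smulA.
have inhQ : inhabited Q.
  by have [x] := semigroup_inhabited S; exists; exact: (f x).
exists (Defs.Semigroup mA inhQ), f; split=> // [q|x y].
  by exists (r q).
by split=> [[]|/fE].
Qed.

Definition word_mul (u v : word) : word := (u.1, u.2 ++ letters v).

Lemma word_mulA : associative word_mul.
Proof. by move=> u v w; rewrite /word_mul /letters /= -catA. Qed.

(** The free semigroup on countably many letters; evaluation in it is substitution. *)
Definition word_semigroup := Defs.Semigroup word_mulA (inhabits (0, [::])).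

Lemma word_evalM (S : semigroup) (h : nat -> S) :
  is_hom (T := S) (word_eval h : word_semigroup -> S).
Proof.
move=> [i s] [j t]; rewrite /word_eval /= foldl_cat /=.
set a := foldl _ (h i) s; elim/last_ind: t => //= t l IH.
by rewrite -!cats1 !foldl_cat /= IH smulA.
Qed.

Lemma word_eval_letters (w : word) :
  word_eval (fun i => (i, [::]) : word_semigroup) w = w.
Proof.
case: w => i s; rewrite /word_eval /=; elim/last_ind: s => //= s j IH.
by rewrite -{1}cats1 foldl_cat /= IH /= -cats1.
Qed.

Lemma theory_subst (K : set semigroup) e (h : nat -> word_semigroup) :
  theory K e -> theory K (word_eval h e.1, word_eval h e.2).
Proof.
move=> Ke S KS g /=.
by rewrite !(hom_word_eval _ _ (word_evalM g)); apply: Ke.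
Qed.

Lemma size_word_eval (h : nat -> word_semigroup) w :
  size w.2 <= size (word_eval h w).2.
Proof.
case: w => i s; rewrite /word_eval /=; elim/last_ind: s => //= s j IH.
rewrite -cats1 foldl_cat /= size_cat size_cat /= addn1 addnS ltnS.
exact: leq_trans IH (leq_addr _ _).
Qed.

(* The element a stands for the length a+1, lengths above k being identified. *)
Definition truncated_add (k a b : nat) := minn (a + b).+1 k.

Lemma truncated_addA k : associative (truncated_add k).
Proof. by move=> a b c; rewrite /truncated_add; lia. Qed.

Definition truncated_semigroup k :=
  Defs.Semigroup (@truncated_addA k) (inhabits 0).

(** The sum is the total length minus one. A one-letter word is evaluated without truncation, hence
    the bound on [size w.2]. *)
Lemma truncated_eval k (h : nat -> truncated_semigroup k) w :
  0 < size w.2 ->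
  word_eval h w = minn (size w.2 + sumn (map h (letters w))) k.
Proof.
case: w => i s; rewrite /word_eval /letters /=.
elim/last_ind: s => //= s j IH _.
rewrite -cats1 foldl_cat map_cat sumn_cat size_cat /=.
case: s IH => [_|l s /(_ isT) ->] /=; rewrite /truncated_add; lia.
Qed.

Lemma truncated_eval0 k w :
  word_eval (fun=> 0 : truncated_semigroup k.+1) w = minn (size w.2) k.+1.
Proof.
case: w => i [|j s] //.
rewrite truncated_eval //= !add0n; congr minn.
by have -> : sumn [seq 0 | _ <- s] = 0; rewrite ?addn0 //; elim: s.
Qed.

(** * Modularity and homogeneous identities *)

Definition com_models (Sigma : set identity) : com_variety :=
  ComVariety (is_varietyI COM_variety (is_variety_models Sigma))
    (@subIsetl _ _ _).

(* [Y] and [Z] below are the commutative varieties given by u = v and u' = v'.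
   Among words no longer than u, identities of [Y] preserve length, so the words
   longer than u form an ideal of the free semigroup of V \/ Y that can be
   collapsed; the quotient lies in [Z], while u and v survive in it. *)
Lemma modular_homogeneous (V : com_variety) (u v u' v' : word) :
  modular_element V ->
  letters u =i letters v -> size u.2 = size v.2 -> 0 < size u.2 ->
  size u.2 < size u'.2 -> size u.2 < size v'.2 ->
  (forall S, commutative_semigroups S ->
     satisfies S (u, v) -> satisfies S (u', v')) ->
  (forall S, variety_class V S -> satisfies S (u', v') -> satisfies S (u, v)) ->
  theory V (u, v).
Proof.
move=> modV luv suv u_gt0 su su' YZ VZ.
pose Y := com_models [set (u, v)]; pose Z := com_models [set (u', v')].
have leYZ : (Y <= Z)%O.
  by apply/com_variety_leP => S [cS SY]; split=> // e ->; apply: YZ (SY _ _).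
have VYE := modV Y Z leYZ.
have VYuv S : variety_class ((V `|` Y) `&` Z)%O S -> satisfies S (u, v).
  rewrite VYE => H; apply: H => S' [[VS' [_ ZS']]|[_ YS']]; last exact: YS'.
  by apply: VZ => //; apply: ZS'.
pose Th := theory ((V : set semigroup) `|` Y).
pose k := size u.2.
(* A word of length [k.+1] has value [k] if all its letters go to [0], and [k.+1] otherwise; this
   depends on its set of letters alone. *)
have Yk : variety_class Y (truncated_semigroup k.+1).
  split=> [a b|e -> h /=].
    by rewrite /= /truncated_add [(a + b)%N]addnC.
  rewrite !truncated_eval -?suv // -/k.
  have sum0 w : (sumn (map h (letters w)) == 0) =
      all (fun i => h i == 0) (letters w).
    by elim: (letters w) => //= i s <-; rewrite addn_eq0.
  have := eq_all_r luv (fun i => h i == 0); rewrite -!sum0; lia.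
have Thk x y : Th (x, y) -> minn (size x.2) k.+1 = minn (size y.2) k.+1.
  by move=> xy; rewrite -!truncated_eval0; apply: (xy _ (or_intror Yk)).
have Th_refl x : Th (x, x) by [].
have Th_sym x y : Th (x, y) -> Th (y, x).
  by move=> xy S KS h; apply/esym/xy.
have Th_trans x y z : Th (x, y) -> Th (y, z) -> Th (x, z).
  by move=> xy yz S KS h; exact: etrans (xy S KS h) (yz S KS h).
have ThM x x' y y' : Th (x, x') -> Th (y, y') ->
    Th (word_mul x y, word_mul x' y').
  move=> xx' yy' S KS h /=; rewrite !(word_evalM h).
  by congr (_ * _); [exact: xx'|exact: yy'].
(* A short word is coded by its [Th]-class, while [None] stands for the whole ideal of words longer
   than [u]. *)
pose c (x : word_semigroup) : option (word -> Prop) :=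
  if k < size x.2 then None else Some (fun y => Th (x, y)).
have cTh x y : Th (x, y) -> c x = c y.
  move=> xy; rewrite /c.
  have -> : (k < size x.2) = (k < size y.2) by have := Thk _ _ xy; lia.
  case: ifP => // _; congr Some; apply/funext => z; apply/propext.
  by split; [apply: Th_trans; apply: Th_sym|apply: Th_trans].
have cP x y : c x = c y -> (k < size x.2 /\ k < size y.2) \/ Th (x, y).
  rewrite /c; case: ifP; case: ifP => // ; first by left.
  by move=> _ _ [E]; right; move: (Th_refl y);
    rewrite -[Th _]/((fun z => Th (y, z)) y) -E.
have cM (x x' y y' : word_semigroup) :
    c x = c x' -> c y = c y' -> c (x * y) = c (x' * y').
  have big (a b : word_semigroup) :
      (k < size a.2) || (k < size b.2) -> c (a * b) = None.
    by rewrite /c /= size_cat /=; case: ifP => //; lia.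
  move=> /cP[[kx kx']|xx']; first by rewrite !big ?kx ?kx'.
  move=> /cP[[ky ky']|yy']; first by rewrite !big ?ky ?ky' ?orbT.
  exact/cTh/ThM.
have [T [f [fM fsurj fc]]] := quotient_semigroup cM.
have cf x y : c x = c y -> f x = f y by move=> /fc.
have TVY : variety_class (V `|` Y)%O T.
  move=> e Te h.
  have [g gK] := choice (fun i => fsurj (h i)).
  have -> : h = f \o g by apply: funext => i /=.
  rewrite -!hom_word_eval //; apply/cf/cTh.
  by have := theory_subst g Te.
have TZ : variety_class Z T.
  split; first exact: variety_commutative TVY.
  move=> e -> h /=.
  have [g gK] := choice (fun i => fsurj (h i)).
  have -> : h = f \o g by apply: funext => i /=.
  rewrite -!hom_word_eval //; apply/cf.
  (* Substitution never shortens a word, so both sides of u' = v' land in the collapsed ideal. *)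
  rewrite /c !ifT //; apply: leq_trans (size_word_eval _ _) => //.
(* Evaluate u = v at the classes of the letters: [u] lies outside the collapsed ideal, so equality
   in [T] means [Th (u, v)]. *)
have := VYuv T (conj TVY TZ) (fun i => f (i, [::])).
rewrite -[fun i => _]/(f \o (fun i => (i, [::]) : word_semigroup)).
rewrite -!hom_word_eval // !word_eval_letters => /fc /cP[|Tuv].
  by rewrite /k ltnn => -[].
by move=> S VS; apply: Tuv; left.
Qed.

(** * Commutative words and periodicity *)

Lemma foldl_perm (A : Type) (J : eqType) (f : A -> J -> A) :
  (forall a i j, f (f a i) j = f (f a j) i) ->
  forall s t a, perm_eq s t -> foldl f a s = foldl f a t.
Proof.
move=> fC; have foldl_rem i t a :
    i \in t -> foldl f a t = foldl f (f a i) (rem i t).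
  elim: t a => //= j t IH a; rewrite inE eq_sym.
  case: eqP => [->|_] //= it; by rewrite IH // fC.
elim=> [|i s IH] t a st.
  by have -> : t = [::] by apply/nilP; rewrite /nilp -(perm_size st).
have it : i \in t by rewrite -(perm_mem st) mem_head.
rewrite (foldl_rem i t) //= (IH (rem i t)) //.
by rewrite -(perm_cons i) (perm_trans st) ?perm_to_rem.
Qed.

Lemma satisfies_perm (S : semigroup) (u v : word) :
  commutative_semigroups S -> perm_eq (letters u) (letters v) ->
  satisfies S (u, v).
Proof.
move=> cS uv h.
(* [None] serves as an adjoined identity, so that the first letter is treated like the others. *)
pose act o i := Some (if o is Some a then a * h i else h i).
have actC o i j : act (act o i) j = act (act o j) i.
  rewrite /act; case: o => [a|]; last by rewrite cS.
  by rewrite -!smulA [h i * h j]cS.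
have evalE w : Some (word_eval h w) = foldl act None (letters w).
  case: w => i s; rewrite /word_eval /= -[act None i]/(Some (h i)).
  by elim: s (h i) => //= j s IH a; rewrite IH.
apply: Some_inj; rewrite !evalE; exact: foldl_perm.
Qed.

Lemma spowM (S : semigroup) (x : S) a b :
  spow x a * spow x b = spow x (a + b).+1.
Proof. by elim: a => //= a IH; rewrite -smulA IH. Qed.

Lemma foldl_nseq (S : semigroup) (h : nat -> S) i a k :
  foldl (fun b j => b * h j) (spow (h i) a) (nseq k i) = spow (h i) (a + k).
Proof.
elim: k a => [|k IH] a /=; first by rewrite addn0.
by rewrite -[_ * h i]/(_ * spow (h i) 0) spowM IH addn0 addSnnS.
Qed.

Lemma word_eval_spow (S : semigroup) (x : S) (g : nat -> nat) w :
  word_eval (fun i => spow x (g i)) w =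
  spow x (size w.2 + sumn (map g (letters w))).
Proof.
case: w => i s; rewrite /word_eval /=; elim/last_ind: s => [|s j IH] /=.
  by rewrite addn0.
rewrite -cats1 foldl_cat IH -/(letters (i, s)) [LHS]spowM /=.
rewrite map_cat sumn_cat size_cat -iterS /=.
by have -> : size s + 1 + (g i + (sumn (map g s) + (g j + 0))) =
  (size s + (g i + sumn (map g s)) + g j).+1 by lia.
Qed.

(** Otherwise, substituting powers of one element into a law of [V] shows that its sides have equal
    weighted length for all weights [g]. Indicator weights count occurrences, so the sides are
    permutations of each other and the law holds in [COM]. *)
Lemma proper_periodic (V : com_variety) : V <> COM ->
  exists n m, 0 < m /\
    forall S, variety_class V S -> forall x : S, spow x n = spow x (n + m).
Proof.
move=> VCOM; apply: contrapT => noper; apply: VCOM; apply: com_variety_eq.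
apply/seteqP; split=> [S|S cS]; first exact: variety_commutative.
rewrite -(models_theory (variety_classP V)) => -[u v] Vuv.
have per p q :
    (forall S', variety_class V S' -> forall x : S', spow x p = spow x q) ->
    p = q.
  move=> H; case: (ltngtP p q) => // pq; case: noper.
    by exists p, (q - p); rewrite subn_gt0 subnKC ?(ltnW pq).
  exists q, (p - q); rewrite subn_gt0 subnKC ?(ltnW pq); split=> // S' VS x.
  exact/esym/H.
have Vg (g : nat -> nat) : size u.2 + sumn (map g (letters u)) =
                           size v.2 + sumn (map g (letters v)).
  by apply: per => S' VS x; rewrite -!word_eval_spow; apply: (Vuv S' VS).
apply: (satisfies_perm cS); rewrite /perm_eq; apply/allP => i _ /=.
have sum0 s : sumn (map (fun=> 0) s) = 0 by elim: s.
have := Vg (fun j => j == i); have := Vg (fun=> 0).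
by rewrite !sum0 !addn0 => -> /addnI; rewrite !sumn_count => /eqP.
Qed.

(** * Absorbing elements *)

Definition absorbing (S : semigroup) (p : S) := forall y, p * y * y = p * y.

Lemma smulAC (S : semigroup) : commutative_semigroups S ->
  right_commutative (@smul S).
Proof. by move=> cS a b c; rewrite -!smulA [b * c]cS. Qed.

Lemma absorbingM (S : semigroup) (p b : S) :
  commutative_semigroups S -> absorbing p -> absorbing (p * b).
Proof.
by move=> cS ap y; rewrite !(smulAC cS p b) (smulAC cS _ b) ap.
Qed.

(** The words below agree in letters and length, as [modular_homogeneous] requires, and periodicity
    hides the shift of the exponent in [V]. *)
Lemma modular_absorbing (V : com_variety) : modular_element V -> V <> COM ->
  exists n, forall S, variety_class V S -> forall x : S, absorbing (spow x n).
Proof.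
move=> modV VCOM; have [n [m [m_gt0 Vnm]]] := proper_periodic VCOM.
(* x^(k+1) y^2 z and x^(k+1) y z^2 *)
pose u k : word := (0, nseq k 0 ++ [:: 1; 1; 2]).
pose v k : word := (0, nseq k 0 ++ [:: 1; 2; 2]).
have evalE (S : semigroup) (h : nat -> S) k s :
    word_eval h (0, nseq k 0 ++ s) =
    foldl (fun a i => a * h i) (spow (h 0) k) s.
  rewrite /word_eval foldl_cat /=; congr foldl.
  exact: (foldl_nseq h 0 0 k).
case: m m_gt0 Vnm => // m _ Vnm.
have Vuv : theory V (u n, v n).
  apply: (@modular_homogeneous V _ _ (u (n + m.+1)) (v (n + m.+1))) => //.
  - by move=> i; rewrite !(inE, mem_cat); do !case: (_ == _); rewrite ?orbT.
  - by rewrite /u /v /= !size_cat.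
  - by rewrite /u /= size_cat addn3.
  - by rewrite /u /= !size_cat !size_nseq /=; lia.
  - by rewrite /u /= !size_cat !size_nseq /=; lia.
  - move=> S cS Suv h; rewrite /= !evalE /= addnS -spowM.
    rewrite [_ * spow _ m]cS -!smulA.
    by congr (_ * _); have := Suv h; rewrite /= !evalE /= -!smulA.
  - by move=> S VS SP h; have := SP h; rewrite /= !evalE /= -!Vnm.
exists n => S VS x y.
have xm : spow x n * spow x m = spow x n by rewrite spowM -addnS -Vnm.
have cS := variety_commutative VS.
(* The value of z is x to the full period, which by [xm] acts as an identity on [spow x n]. *)
have := Vuv S VS (nth x [:: x; y; spow x m]); rewrite /= !evalE /=.
rewrite (smulAC cS (spow x n * y) y) !(smulAC cS (spow x n) y (spow x m)) !xm.
by rewrite (smulAC cS (spow x n) y (spow x m)) xm.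
Qed.

Lemma mul_word_eval (S : semigroup) (h : nat -> S) p w :
  p * word_eval h w = foldl (fun a j => a * h j) p (letters w).
Proof.
case: w => i s; rewrite /word_eval /=.
by elim: s (h i) => //= j s IH a; rewrite IH smulA.
Qed.

Lemma mul_word_eval_fixed (S : semigroup) (h : nat -> S) p w :
  (forall i, i \in letters w -> p * h i = p) -> p * word_eval h w = p.
Proof.
rewrite mul_word_eval; elim: (letters w) => //= i s IH ph.
by rewrite ph ?mem_head // IH // => j js; rewrite ph // inE js orbT.
Qed.

Lemma mul_word_eval_absorb (S : semigroup) (h : nat -> S) p w i :
  commutative_semigroups S -> absorbing p -> i \in letters w ->
  p * word_eval h w * h i = p * word_eval h w.
Proof.
move=> cS; rewrite mul_word_eval.
elim: (letters w) p => //= j s IH p ap; rewrite inE.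
case: (boolP (i \in s)) => [js _|_].
  by apply: IH js; apply: absorbingM.
(* At the last occurrence of the letter, its value is doubled and the copy is carried to the right
   end. *)
rewrite orbF => /eqP ->; rewrite -[in RHS](ap (h j)).
elim: s (p * h j) {IH} => //= l s IH a.
by rewrite IH (smulAC cS).
Qed.

(** Each value is fixed by all its letters, hence by the other value: u = uv = vu = v. *)
Lemma word_eval_eq_letters (S : semigroup) (h : nat -> S) u v :
  commutative_semigroups S -> letters u =i letters v ->
  (forall w, w \in [:: u; v] ->
     absorbing (word_eval h w) /\
     word_eval h w * word_eval h w = word_eval h w) ->
  word_eval h u = word_eval h v.
Proof.
move=> cS uv H.
have [au iu] := H u (mem_head _ _).
have [av iv] := H v (mem_last u [:: v]).
have fixed w w' : letters w =i letters w' -> absorbing (word_eval h w) ->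
    word_eval h w * word_eval h w = word_eval h w ->
    word_eval h w * word_eval h w' = word_eval h w.
  move=> ww' aw iw; apply: mul_word_eval_fixed => i; rewrite -ww' => wi.
  by rewrite -{1}iw mul_word_eval_absorb // iw.
by rewrite -(fixed u v) // cS fixed // => i; rewrite uv.
Qed.

(** * Semilattices and nil-semigroups *)

Definition or_semigroup := Defs.Semigroup orbA (inhabits true).

(** The two-element semilattice detects whether a letter occurs: send that letter to [true] and all
    others to [false]. *)
Lemma semilattices_letters (u v : word) :
  (forall S, semilattices S -> satisfies S (u, v)) <-> letters u =i letters v.
Proof.
split=> [H i|uv S [cS iS] h]; last first.
  apply: word_eval_eq_letters => // w _; split; last exact: iS.
  by move=> y; rewrite -smulA iS.
have SLor : semilattices or_semigroup by split; [exact: orbC|exact: orbb].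
have evalE w : word_eval (fun j => i == j : or_semigroup) w = (i \in letters w).
  case: w => j s; rewrite /word_eval /letters /= inE.
  by elim: s (i == j) => [|l s IH] b /=; rewrite ?orbF // IH inE orbA.
by rewrite -!evalE; exact: (H _ SLor).
Qed.

(* x^(n+1) y = x^(n+1) *)
Definition zero_pow n : identity := ((0, nseq n 0 ++ [:: 1]), (0, nseq n 0)).

Lemma satisfies_zero_powP (S : semigroup) n :
  satisfies S (zero_pow n) <-> forall x y : S, spow x n * y = spow x n.
Proof.
have evalE (h : nat -> S) :
    foldl (fun a i => a * h i) (h 0) (nseq n 0) = spow (h 0) n.
  exact: (foldl_nseq h 0 0 n).
split=> [H x y|H h]; last by rewrite /word_eval /= foldl_cat /= evalE H.
have := H (fun i => if i is 0 then x else y).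
by rewrite /word_eval /= foldl_cat /= evalE.
Qed.

(** Each [spow x n] is a zero, and a semigroup has at most one zero. *)
Lemma nil_zero_pow (S : semigroup) n :
  commutative_semigroups S -> (forall x y : S, spow x n * y = spow x n) ->
  nil_semigroups S.
Proof.
move=> cS zS; have [x0] := semigroup_inhabited S.
exists (spow x0 n) => [|x].
  by split=> x; rewrite ?[x * _]cS zS.
by exists n; rewrite -(zS x (spow x0 n)) cS zS.
Qed.

Lemma not_SL_zero_pow (V : com_variety) n :
  (forall S, variety_class V S -> forall x : S,
     absorbing (spow x n) /\ spow x n * x = spow x n) ->
  ~ (semilattices `<=` V) ->
  forall S, variety_class V S -> forall x y : S, spow x n * y = spow x n.
Proof.
move=> Vn nSL S VS x y; have cS := variety_commutative VS.
have [ap px] := Vn S VS x.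
have [[u v] Vuv [i iu iv]] : exists2 e, theory V e &
    exists2 i, i \in letters e.1 & i \notin letters e.2.
  apply: contrapT => H; apply: nSL => S' SLS'.
  rewrite -(models_theory (variety_classP V)) => -[u v] Vuv.
  apply: (proj2 (semilattices_letters u v)) SLS' => i; apply/idP/idP => iw.
    by apply: contrapT => /negP niw; apply: H; exists (u, v) => //; exists i.
  apply: contrapT => /negP niw; apply: H; exists (v, u); last by exists i.
  by move=> S0 VS0 h; apply/esym/Vuv.
(* Multiplied by [spow x n], the side without [i] disappears, while the side with [i] absorbs
   [y]. *)
pose h j := if j == i then y else x.
have pv : spow x n * word_eval h v = spow x n.
  apply: mul_word_eval_fixed => j jv; rewrite /h.
  by case: eqP jv iv => [-> ->|].
have pu := mul_word_eval_absorb h cS ap iu.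
by move: pu; rewrite (Vuv S VS h) pv /h eqxx.
Qed.

(** * The Rees quotient by the ideal of powers *)

Definition power_ideal (S : semigroup) n (s : S) :=
  exists x b, s = spow x n * b.

Lemma rees_quotient (S : semigroup) n :
  commutative_semigroups S -> (forall x : S, spow x n * x = spow x n) ->
  exists (T : semigroup) (f : S -> T),
  [/\ is_hom f, forall y, exists x, f x = y,
      forall x y : T, spow x n * y = spow x n
    & forall x y, f x = f y -> x = y \/ power_ideal n x /\ power_ideal n y].
Proof.
move=> cS px.
pose k (s : S) := if `[< power_ideal n s >] then None else Some s.
have kP x y : k x = k y -> x = y \/ power_ideal n x /\ power_ideal n y.
  rewrite /k; case: asboolP => Ix; case: asboolP => Iy //; first by right.
  by move=> [->]; left.
have kI x : power_ideal n x -> k x = None by move=> Ix; rewrite /k asboolT.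
have IM x y : power_ideal n x -> power_ideal n (x * y).
  by move=> [z [b ->]]; exists z, (b * y); rewrite smulA.
have kM x x' y y' : k x = k x' -> k y = k y' -> k (x * y) = k (x' * y').
  move=> /kP kx /kP[->|[Iy Iy']].
    by case: kx => [-> //|[Ix Ix']]; rewrite !kI //; apply: IM.
  by rewrite [x * y]cS [x' * y']cS !kI //; apply: IM.
have [T [f [fM fsurj fk]]] := quotient_semigroup kM.
exists T, f; split=> // [a b|x y /fk /kP //].
have [[x <-] [y <-]] := (fsurj a, fsurj b).
have fpow : spow (f x) n = f (spow x n).
  by elim: n {px k kP kI IM kM fk} => //= m ->.
(* The required factor [b] is [x] itself, by [px]. *)
have In : power_ideal n (spow x n) by exists x, x.
by rewrite fpow -fM; apply/fk; rewrite !kI //; apply: IM.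
Qed.

(** With p = [spow x n] idempotent and absorbing, (pb)(pb) = pbb = pb. *)
Lemma power_ideal_absorbing (S : semigroup) n (s : S) :
  commutative_semigroups S ->
  (forall x : S, absorbing (spow x n) /\ spow x n * x = spow x n) ->
  power_ideal n s -> absorbing s /\ s * s = s.
Proof.
move=> cS H [x [b ->]]; have [ax px] := H x.
split; first exact: absorbingM.
have pp m : spow x n * spow x m = spow x n.
  by elim: m => [|m IH] //=; rewrite smulA px.
by rewrite smulA (smulAC cS _ b) pp ax.
Qed.

Theorem theorem1p4 (V : com_variety) (modularV : modular_element V) :
  V = COM \/
  exists M N : com_variety,
    [/\ M = TRIV \/ M = SL, nil_variety N & V = (M `|` N)%O].
Proof.
have [->|VCOM] := pselect (V = COM); [by left|right].
have [m Vm] := modular_absorbing modularV VCOM.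
have [n Vn] : exists n, forall S, variety_class V S -> forall x : S,
    absorbing (spow x n) /\ spow x n * x = spow x n.
  (* One more factor [x] is needed: absorption at y = x then reads
     [spow x m * x * x = spow x m * x]. *)
  exists m.+1 => S VS x; have cS := variety_commutative VS.
  have -> : spow x m.+1 = spow x m * x by rewrite cS.
  by split; [apply: absorbingM (Vm S VS x)|apply: Vm].
have [SLV|nSLV] := pselect (semilattices `<=` V); last first.
  exists TRIV, V; split; first by left.
    move=> S VS; have cS := variety_commutative VS.
    exact: nil_zero_pow cS (not_SL_zero_pow Vn nSLV VS).
  apply/esym/join_r/com_variety_leP => S trS.
  rewrite -(models_theory (variety_classP V)) => e _ h; exact: trS.
exists SL, (com_meet V (com_models [set zero_pow n])); split; first by right.
  move=> S [VS [cS Sn]]; apply: (@nil_zero_pow S n) => //.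
  by apply/satisfies_zero_powP/Sn.
apply/le_anti/andP; rewrite com_joinE; split; apply/com_variety_leP; last first.
  apply/(variety_join_least _ _ (variety_classP V)); split=> //.
  by move=> S [].
move=> S VS -[u v] SLNuv h; have cS := variety_commutative VS.
have [T [f [fM fsurj Tn fI]]] := rees_quotient cS (fun x => (Vn S VS x).2).
have VT : variety_class V T.
  rewrite -(models_theory (variety_classP V)) => e Ve.
  exact: satisfies_image fM fsurj (Ve S VS).
have uv : letters u =i letters v.
  by apply/semilattices_letters => S' SLS'; apply: SLNuv; left.
have Tuv : satisfies T (u, v).
  apply: SLNuv; right; split=> //; split; first exact: variety_commutative VT.
  by move=> e ->; apply/satisfies_zero_powP.
(* Either the two values already agree in [S], or both lie in the ideal, where the letters determine
   the value. *)
have := Tuv (f \o h); rewrite -!hom_word_eval // => /fI[//|[Iu Iv]].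
apply: word_eval_eq_letters => // w.
by rewrite !inE => /orP[]/eqP ->; apply: power_ideal_absorbing (Vn S VS) _.
Qed.
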